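(* Let $\mathcal{M}$ be a smooth connected manifold and let $\mathrm{g}\in\mathrm{Met}(\mathcal{M})$ be a rough Riemannian metric. Then the component $\mathrm{Comp}(\mathrm{g})=\{\mathrm{h}\in\mathrm{Met}(\mathcal{M}):\mathbb{d}^{\mathcal{M}}(\mathrm{g},\mathrm{h})<\infty\}$ is path-connected (in the topology induced by $\mathbb{d}^{\mathcal{M}}$).
   Context: $\mathcal{M}$ carries a smooth differentiable structure and has no boundary. A set $Z\subset\mathcal{M}$ has measure zero if its image in every smooth chart has Lebesgue measure zero; ''almost every'' (a.e.) refers to this notion. A rough Riemannian metric on $\mathcal{M}$ is a measurable symmetric $(2,0)$-tensor field $\mathrm{g}$ (a measurable section of symmetric bilinear forms on $T\mathcal{M}$; fields agreeing a.e. are identified) such that for every $x\in\mathcal{M}$ there is a chart $(U,\psi)$ near $x$ and a constant $C_U\ge 1$ with $C_U^{-1}|u|_{\psi^*\delta(y)}\le |u|_{\mathrm{g}(y)}\le C_U|u|_{\psi^*\delta(y)}$ for almost every $y\in U$ and all $u\in T_yU$. Here $|u|_{\mathrm{g}(y)}=\sqrt{\mathrm{g}(y)[u,u]}$ and $\delta$ is the Euclidean metric. $\mathrm{Met}(\mathcal{M})$ is the set of all rough Riemannian metrics on $\mathcal{M}$. For $C\ge1$, write $\mathrm{g}\sim_C\mathrm{h}$ if $C^{-1}|u|_{\mathrm{h}(x)}\le|u|_{\mathrm{g}(x)}\le C|u|_{\mathrm{h}(x)}$ for almost every $x\in\mathcal{M}$ and all $u\in T_x\mathcal{M}$. The extended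 metric $\mathbb{d}^{\mathcal{M}}$ on $\mathrm{Met}(\mathcal{M})$ is $\mathbb{d}^{\mathcal{M}}(\mathrm{g},\mathrm{h})=\inf\{\log C: C\ge 1,\ \mathrm{g}\sim_C\mathrm{h}\}$ if some such $C$ exists, and $+\infty$ otherwise. *)

(* Defs.v *)
From HB Require Import structures.
From mathcomp Require Import all_boot all_order all_algebra generic_quotient.
From mathcomp Require Import all_classical all_reals all_analysis.
Import numFieldNormedType.Exports.

Set Implicit Arguments.
Unset Strict Implicit.
Unset Printing Implicit Defensive.

Import Order.TTheory GRing.Theory Num.Theory.

Local Open Scope classical_set_scope.
Local Open Scope ring_scope.
Local Open Scope quotient_scope.

Section lebesgue_outer.
Context (R : realType) (n : nat).
Implicit Types (a b : 'rV[R]_n) (A : set 'rV[R]_n).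

Definition box a b : set 'rV[R]_n :=
  [set x | forall i, a 0 i < x 0 i <= b 0 i].

(* The volume is +oo on sets that are neither boxes nor empty; the empty set
   is not a box when n = 0, hence the separate clause. *)
Definition box_volume A : \bar R := ereal_inf
  ([set (\prod_i (b.2 0 i - b.1 0 i))%:E | b in
      [set b : 'rV[R]_n * 'rV[R]_n |
        (forall i, b.1 0 i <= b.2 0 i) /\ A = box b.1 b.2]]
   `|` [set v | A = set0 /\ v = 0%E]).

Definition lebesgue_outer A : \bar R := ereal_inf
  [set (\sum_(k <oo) box_volume (F k))%E | F in
     [set F : nat -> set 'rV[R]_n | A `<=` \bigcup_k F k]].

Lemma box_volume_ge0 A : (0 <= box_volume A)%E.
Proof.
apply: le_ereal_inf_tmp => x; case=> [[[a b] /= [ab _] <-]|[_ ->//]].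
by rewrite lee_fin; apply: prodr_ge0 => i _; rewrite subr_ge0.
Qed.

Lemma box_volume0 : box_volume set0 = 0%E.
Proof.
apply/eqP; rewrite eq_le box_volume_ge0 andbT.
by apply: ereal_inf_lbound; right.
Qed.

Lemma lebesgue_outerE :
  lebesgue_outer = @mu_ext _ (g_sigma_algebraType [set: set 'rV[R]_n]) R
                     box_volume.
Proof.
apply/funext => A; congr ereal_inf.
apply/seteqP; split=> _ [F FA <-]; exists F => //; last by case: FA.
by split=> // i; apply: sub_gen_smallest.
Qed.

Lemma lebesgue_outer0 : lebesgue_outer set0 = 0%E.
Proof.
by rewrite lebesgue_outerE mu_ext0//; [exact: box_volume0|exact: box_volume_ge0].
Qed.

Lemma lebesgue_outer_ge0 A : (0 <= lebesgue_outer A)%E.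
Proof. by rewrite lebesgue_outerE mu_ext_ge0//; exact: box_volume_ge0. Qed.

Lemma le_lebesgue_outer :
  {homo lebesgue_outer : A B / A `<=` B >-> (A <= B)%E}.
Proof.
move=> A B AB; rewrite lebesgue_outerE.
exact: (@le_mu_ext _ (g_sigma_algebraType [set: set 'rV[R]_n]) R box_volume A B).
Qed.

Lemma lebesgue_outer_sigma_subadditive : sigma_subadditive lebesgue_outer.
Proof.
rewrite lebesgue_outerE.
exact: (@mu_ext_sigma_subadditive _ (g_sigma_algebraType [set: set 'rV[R]_n]) R
          box_volume box_volume_ge0).
Qed.

HB.instance Definition _ := isOuterMeasure.Build R 'rV[R]_n lebesgue_outer
  lebesgue_outer0 lebesgue_outer_ge0 le_lebesgue_outer
  lebesgue_outer_sigma_subadditive.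

End lebesgue_outer.

(* R^n with the sigma-algebra of Lebesgue measurable sets. *)
Definition lebesgue_space (R : realType) (n : nat) :=
  caratheodory_type (@lebesgue_outer R n).
HB.instance Definition _ (R : realType) (n : nat) :=
  Measurable.on (@lebesgue_space R n).

Fixpoint Ck (R : realType) (m n k : nat) (U : set 'rV[R]_m)
    (f : 'rV[R]_m -> 'rV[R]_n) : Prop :=
  if k is k'.+1 then
    (forall x, U x -> differentiable f x) /\ (forall v, Ck k' U ('D_v f))
  else forall x, U x -> {for x, continuous f}.

Definition smooth (R : realType) (m n : nat) (U : set 'rV[R]_m)
    (f : 'rV[R]_m -> 'rV[R]_n) : Prop :=
  forall k, Ck k U f.

(* A chart of M; the inverse is a total function whose values outside the
   image of the chart are irrelevant. *)
Record chart (R : realType) (n : nat) (M : topologicalType) := Chart {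
  cdom : set M ;
  cmap : M -> 'rV[R]_n ;
  cinv : 'rV[R]_n -> M ;
  cdom_open : open cdom ;
  cimg_open : open (cmap @` cdom) ;
  cmapK : forall x, cdom x -> cinv (cmap x) = x ;
  cmap_continuous : forall x, cdom x -> {for x, continuous cmap} ;
  cinv_continuous : forall y, (cmap @` cdom) y -> {for y, continuous cinv} }.

Definition smoothly_compatible (R : realType) (n : nat) (M : topologicalType)
    (c d : chart R n M) : Prop :=
  smooth (cmap c @` (cdom c `&` cdom d)) (cmap d \o cinv c) /\
  smooth (cmap d @` (cdom c `&` cdom d)) (cmap c \o cinv d).

Record smoothManifold (R : realType) (n : nat) := SmoothManifold {
  carrier :> topologicalType ;
  manifold_hausdorff : hausdorff_space carrier ;
  manifold_second_countable : @second_countable carrier ;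
  atlas : set (chart R n carrier) ;
  atlas_cover : forall x, exists2 c, atlas c & cdom c x ;
  atlas_compatible : forall c d, atlas c -> atlas d -> smoothly_compatible c d ;
  atlas_maximal : forall c,
    (forall d, atlas d -> smoothly_compatible c d) -> atlas c }.

Section tangent.
Context (R : realType) (n : nat) (M : smoothManifold R n).
Implicit Types (x : M) (c d : chart R n M).

Definition charts_at x : set (chart R n M) := [set c | atlas c /\ cdom c x].

Definition transition_diff x c d : 'rV[R]_n -> 'rV[R]_n :=
  'd (cmap d \o cinv c) (cmap c x).

(* A tangent vector at x is the family of its coordinates in the charts around
   x, transforming by the differentials of the transition maps.  Charts that
   are not around x carry the dummy value 0. *)
Definition is_tangent x : {pred chart R n M -> 'rV[R]_n} :=
  fun v => `[< (forall c d, charts_at x c -> charts_at x d ->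
                  v d = transition_diff x c d (v c)) /\
               (forall c, ~ charts_at x c -> v c = 0) >].

Lemma is_tangent_submod x : GRing.subsemimod_closed (is_tangent x).
Proof.
split; first split.
- apply/asboolP; split=> [c d _ _|//].
  by rewrite /transition_diff /= linear0.
- move=> u v /asboolP[u1 u2] /asboolP[v1 v2]; apply/asboolP; split=> [c d xc xd|c xc].
    by rewrite /transition_diff /= !fctE linearD /= (u1 c d)// (v1 c d).
  by rewrite fctE u2// v2// addr0.
- move=> a v /asboolP[v1 v2]; apply/asboolP; split=> [c d xc xd|c xc].
    by rewrite /transition_diff /= !fctE linearZ /= (v1 c d).
  by rewrite fctE v2// scaler0.
Qed.

Record tangent x := Tangent {
  tcoord :> chart R n M -> 'rV[R]_n ;
  tcoordP : tcoord \in is_tangent x }.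

HB.instance Definition _ x := [isSub for @tcoord x].
HB.instance Definition _ x := gen_eqMixin (tangent x).
HB.instance Definition _ x := gen_choiceMixin (tangent x).
HB.instance Definition _ x :=
  GRing.SubChoice_isSubLmodule.Build R (chart R n M -> 'rV[R]_n)
    (is_tangent x) (tangent x) (is_tangent_submod x).


(* The tangent vector at x whose coordinates in the chart c are e; it is the
   zero vector when c is not a chart around x. *)
Definition tangent_of x c (e : 'rV[R]_n) : tangent x :=
  insubd (0 : tangent x)
    (fun d => if `[< charts_at x c /\ charts_at x d >]
              then transition_diff x c d e else 0).

Lemma transition_differentiable x c d : charts_at x c -> charts_at x d ->
  differentiable (cmap d \o cinv c) (cmap c x).
Proof.
move=> [ac xc] [ad xd]; have [/(_ 1%N)[+ _] _] := atlas_compatible ac ad.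
by apply; exists x.
Qed.

Lemma near_cinv x c (A : set M) : cdom c x -> nbhs x A ->
  \forall y \near cmap c x, A (cinv c y).
Proof.
move=> xc xA; have : {for cmap c x, continuous (cinv c)}.
  by apply: cinv_continuous; exists x.
by rewrite /prop_for /continuous_at cmapK//; apply.
Qed.

Lemma near_cdom x c : cdom c x -> nbhs x (cdom c).
Proof. by move=> xc; apply: open_nbhs_nbhs; split => //; exact: cdom_open. Qed.

Lemma transition_diff_id x c : charts_at x c -> transition_diff x c c =1 id.
Proof.
move=> xc e; rewrite /transition_diff.
have dt := transition_differentiable xc xc.
rewrite -deriveE// (@near_eq_derive _ _ _ _ id); last first.
  have [_ xc'] := xc.
  have : nbhs (cmap c x) (cmap c @` cdom c).
    by apply: open_nbhs_nbhs; split; [exact: cimg_open|exists x].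
  by apply: filterS => _ [y yc <-] /=; rewrite cmapK.
by rewrite derive_id.
Qed.

Lemma diff_near_comp (V : normedModType R) (f g h : V -> V) (p q v : V) :
  f p = q -> differentiable f p -> differentiable g q -> differentiable h p ->
  (\near p, g (f p) = h p) -> 'd g q ('d f p v) = 'd h p v.
Proof.
move=> <- df dg dh fgh.
transitivity ('d (g \o f) p v); first by rewrite (diff_comp df dg).
transitivity ('D_v (g \o f) p).
  by rewrite deriveE//; exact: differentiable_comp.
by rewrite -(deriveE v dh); exact: near_eq_derive.
Qed.

Lemma transition_diff_comp x c d d' :
  charts_at x c -> charts_at x d -> charts_at x d' ->
  forall e, transition_diff x d d' (transition_diff x c d e) =
            transition_diff x c d' e.
Proof.
move=> xc xd xd' e; apply: diff_near_comp.
- by rewrite /= cmapK//; case: xc.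
- exact: transition_differentiable.
- exact: transition_differentiable.
- exact: transition_differentiable.
have [_ xc'] := xc; have [_ xd''] := xd.
have := near_cinv xc' (near_cdom xd''); apply: filterS => y yd /=.
by rewrite cmapK.
Qed.

Lemma tangent_ofE x c e d : charts_at x c -> charts_at x d ->
  tangent_of x c e d = transition_diff x c d e.
Proof.
move=> xc xd; rewrite /tangent_of /insubd insubT/=.
  apply/asboolP; split=> [c' d' xc' xd'|c' xc'].
    by rewrite !asboolT// transition_diff_comp.
  by rewrite asboolF// => -[].
by move=> ?; rewrite asboolT.
Qed.

Lemma tangent_of_coord x c e : charts_at x c -> tangent_of x c e c = e.
Proof. by move=> xc; rewrite tangent_ofE// transition_diff_id. Qed.

End tangent.

Section rough.
Context (R : realType) (n : nat) (M : smoothManifold R n).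
Implicit Types (x : M) (c : chart R n M).

Definition null_set (Z : set M) : Prop :=
  forall c, atlas c -> lebesgue_outer (cmap c @` (Z `&` cdom c)) = 0%E.

Definition ae_on (U : set M) (P : M -> Prop) : Prop :=
  null_set [set x | U x /\ ~ P x].

Record sym_form_field := SymFormField {
  form :> forall x, tangent x -> tangent x -> R ;
  form_sym : forall x (u v : tangent x), form u v = form v u ;
  form_bilinear : forall x, bilinear_for *%R *%R (@form x) }.
Arguments form : clear implicits.

(* Measurability of the section: in every chart, the coefficients with respect
   to the coordinate frame are Lebesgue measurable. *)
Definition form_measurable (g : sym_form_field) : Prop :=
  forall c, atlas c -> forall i j : 'I_n,
    measurable_fun (cmap c @` cdom c : set (lebesgue_space R n))
      (fun y => g (cinv c y) (tangent_of (cinv c y) c (delta_mx 0 i))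
                             (tangent_of (cinv c y) c (delta_mx 0 j))).

Definition form_norm (g : sym_form_field) x (u : tangent x) : R :=
  Num.sqrt (g x u u).

(* The norm of the pullback by the chart c of the Euclidean metric. *)
Definition chart_norm c x (u : tangent x) : R :=
  Num.sqrt (\sum_(i < n) (u c 0 i) ^+ 2).

Definition locally_comparable (g : sym_form_field) : Prop :=
  forall x, exists2 c, charts_at x c & exists2 C : R, 1 <= C &
    ae_on (cdom c) (fun y => forall u : tangent y,
      C^-1 * chart_norm c u <= form_norm g u <= C * chart_norm c u).

Record rough_metric := RoughMetric {
  rough_form :> sym_form_field ;
  rough_measurable : form_measurable rough_form ;
  rough_comparable : locally_comparable rough_form }.

HB.instance Definition _ := gen_eqMixin rough_metric.
HB.instance Definition _ := gen_choiceMixin rough_metric.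

Implicit Types g h k : rough_metric.

Definition ae_equal g h : Prop :=
  ae_on setT (fun x => forall u v : tangent x, g x u v = h x u v).

Definition metric_sim (C : R) g h : Prop :=
  ae_on setT (fun x => forall u : tangent x,
    C^-1 * form_norm h u <= form_norm g u <= C * form_norm h u).

Definition rough_dist g h : \bar R :=
  ereal_inf [set (ln C)%:E | C in [set C | 1 <= C /\ metric_sim C g h]].

Lemma null_setS (Y Z : set M) : Y `<=` Z -> null_set Z -> null_set Y.
Proof.
move=> YZ Z0 c ac; apply/eqP; rewrite eq_le lebesgue_outer_ge0 andbT -(Z0 c ac).
by apply: le_lebesgue_outer; apply: image_subset; apply: setSI.
Qed.

Lemma null_setU (Y Z : set M) : null_set Y -> null_set Z -> null_set (Y `|` Z).
Proof.
move=> Y0 Z0 c ac; apply/eqP; rewrite eq_le lebesgue_outer_ge0 andbT.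
rewrite setIUl image_setU -[leRHS]adde0 -{1}(Y0 c ac) -(Z0 c ac).
exact: outer_measureU2.
Qed.

Lemma null_set0 : null_set set0.
Proof. by move=> c _; rewrite set0I image_set0 lebesgue_outer0. Qed.

Lemma ae_all (U : set M) (P : M -> Prop) : (forall x, P x) -> ae_on U P.
Proof. by move=> HP; apply: null_setS null_set0 => x [_ /(_ (HP x))]. Qed.

Lemma ae_imply (U : set M) (P Q : M -> Prop) :
  (forall x, P x -> Q x) -> ae_on U P -> ae_on U Q.
Proof. by move=> PQ; apply: null_setS => x [Ux nQ]; split=> // /PQ. Qed.

Lemma ae_imply2 (U : set M) (P Q S : M -> Prop) :
  (forall x, P x -> Q x -> S x) -> ae_on U P -> ae_on U Q -> ae_on U S.
Proof.
move=> PQS P0 Q0; apply: null_setS (null_setU P0 Q0) => x [Ux nS].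
have [Px|nP] := pselect (P x); last by left.
by right; split=> // Qx; apply: nS; exact: PQS.
Qed.

Lemma ae_equal_refl g : ae_equal g g.
Proof. exact: ae_all. Qed.

Lemma ae_equal_sym g h : ae_equal g h -> ae_equal h g.
Proof. by apply: ae_imply => x gh u v; rewrite gh. Qed.

Lemma ae_equal_trans h g k : ae_equal g h -> ae_equal h k -> ae_equal g k.
Proof. by apply: ae_imply2 => x gh hk u v; rewrite gh. Qed.

Definition ae_equalb g h : bool := `[< ae_equal g h >].

Lemma ae_equalb_refl : reflexive ae_equalb.
Proof. by move=> g; apply/asboolP; exact: ae_equal_refl. Qed.

Lemma ae_equalb_sym : symmetric ae_equalb.
Proof. by move=> g h; apply/asboolP/asboolP; exact: ae_equal_sym. Qed.

Lemma ae_equalb_trans : transitive ae_equalb.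
Proof.
by move=> h g k /asboolP gh /asboolP hk; apply/asboolP; exact: ae_equal_trans hk.
Qed.

Canonical ae_equiv :=
  EquivRel ae_equalb ae_equalb_refl ae_equalb_sym ae_equalb_trans.

Lemma metric_sim_ae C g g' h h' : ae_equal g g' -> ae_equal h h' ->
  metric_sim C g h -> metric_sim C g' h'.
Proof.
move=> gg' hh'.
have := ae_imply2 (fun x p q => conj p q) gg' hh'; apply: ae_imply2.
by move=> x [p q] H u; move: (H u); rewrite /form_norm p q.
Qed.

Lemma metric_sim_refl g : metric_sim 1 g g.
Proof. by apply: ae_all => x u; rewrite invr1 !mul1r lexx. Qed.

Lemma metric_sim_sym C g h : 1 <= C -> metric_sim C g h -> metric_sim C h g.
Proof.
move=> C1; have C0 : 0 < C by rewrite (lt_le_trans _ C1).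
apply: ae_imply => x H u; have /andP[H1 H2] := H u.
by rewrite ler_pdivrMl// H2/= -ler_pdivrMl.
Qed.

Lemma metric_sim_trans C D g h k : 1 <= C -> 1 <= D ->
  metric_sim C g h -> metric_sim D h k -> metric_sim (C * D) g k.
Proof.
move=> C1 D1; have C0 : 0 < C by rewrite (lt_le_trans _ C1).
have D0 : 0 < D by rewrite (lt_le_trans _ D1).
apply: ae_imply2 => x gh hk u.
have /andP[gh1 gh2] := gh u; have /andP[hk1 hk2] := hk u.
apply/andP; split.
  by rewrite invfM -mulrA (le_trans _ gh1)// ler_pM2l// invr_gt0.
by rewrite -mulrA (le_trans gh2)// ler_pM2l.
Qed.

Lemma rough_dist_ltP g h (e : R) : (rough_dist g h < e%:E)%E <->
  exists C, [/\ 1 <= C, metric_sim C g h & ln C < e].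
Proof.
split=> [/ereal_inf_lt[_ [C [C1 gh] <-]]|[C [C1 gh Ce]]].
  by rewrite lte_fin => Ce; exists C.
rewrite (le_lt_trans _ (_ : (ln C)%:E < _)%E) ?lte_fin//.
by apply: ereal_inf_lbound; exists C.
Qed.

(* Met(M): rough metrics up to equality almost everywhere. *)
Definition Met := {eq_quot ae_equiv}%qT.
HB.instance Definition _ := Choice.on Met.
HB.instance Definition _ := EqQuotient.on Met.

End rough.

Section Met_topology.
Context (R : realType) (n : nat) (M : smoothManifold R n).
Implicit Types x y z : Met M.

Definition Met_dist x y : \bar R := rough_dist (repr x) (repr y).

Lemma Met_distE (g h : rough_metric M) : Met_dist (\pi_(Met M) g) (\pi_(Met M) h) = rough_dist g h.
Proof.
have ae_repr k : ae_equal (repr (\pi_(Met M) k)) k.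
  have : repr (\pi_(Met M) k) = k %[mod Met M] by rewrite reprK.
  by move/(@eqquotP _ _ (Met M)) => /asboolP.
congr ereal_inf; apply/seteqP; split=> _ [C [C1 gh] <-]; exists C => //; split=> //.
  exact: metric_sim_ae gh.
by apply: metric_sim_ae gh; exact/ae_equal_sym.
Qed.

Definition Met_ball x (e : R) y : Prop := (Met_dist x y < e%:E)%E.

Lemma Met_ball_center x (e : R) : 0 < e -> Met_ball x e x.
Proof.
move=> e0; apply/rough_dist_ltP; exists 1; split=> //; last by rewrite ln1.
exact: metric_sim_refl.
Qed.

Lemma Met_ball_sym x y (e : R) : Met_ball x e y -> Met_ball y e x.
Proof.
move=> /rough_dist_ltP[C [C1 xy Ce]]; apply/rough_dist_ltP; exists C; split=> //.
exact: metric_sim_sym.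
Qed.

Lemma Met_ball_triangle x y z (e1 e2 : R) :
  Met_ball x e1 y -> Met_ball y e2 z -> Met_ball x (e1 + e2) z.
Proof.
move=> /rough_dist_ltP[C [C1 xy Ce]] /rough_dist_ltP[D [D1 yz De]].
apply/rough_dist_ltP; exists (C * D); split; first by rewrite -[1]mulr1 ler_pM.
  exact: metric_sim_trans yz.
by rewrite lnM ?ltrD// posrE (lt_le_trans ltr01).
Qed.

(* The topology of Met(M) is the one induced by the extended metric. *)
HB.instance Definition _ :=
  hasNbhs.Build (Met M) (nbhs_ (entourage_ Met_ball)).
HB.instance Definition _ := @Nbhs_isPseudoMetric.Build R (Met M)
  (entourage_ Met_ball) erefl Met_ball
  Met_ball_center Met_ball_sym Met_ball_triangle erefl.

Definition Comp x : set (Met M) := [set y | (Met_dist x y < +oo)%E].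

End Met_topology.

Definition path_connected (R : realType) (T : topologicalType) (A : set T) : Prop :=
  forall x y : T, A x -> A y ->
    exists p : R -> T,
      [/\ {within `[0, 1], continuous p}, p 0 = x, p 1 = y &
          forall t, t \in `[0, 1] -> A (p t)].

(* Main.v *)
Require Import Defs.
From mathcomp Require Import all_boot all_order all_algebra.
From mathcomp Require Import generic_quotient lra.
From mathcomp Require Import all_classical all_reals all_analysis.
From mathcomp Require Import measurable_realfun.
Local Open Scope classical_set_scope.

Set Implicit Arguments.
Unset Strict Implicit.
Unset Printing Implicit Defensive.

Import Order.TTheory GRing.Theory Num.Theory.
Local Open Scope ring_scope.
Local Open Scope quotient_scope.

(** Two points of the component are represented by rough metrics [a] and [b]
    with [C^-1 |u|_b <= |u|_a <= C |u|_b] almost everywhere, and the straight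
    segment [(1 - t) a + t b] joins them continuously.

    Where [a] and [b] are nonnegative, the squared norms [p = a(u, u)] and
    [q = b(u, u)] satisfy [p <= K q] and [q <= K p] with [K = C ^ 2].  Hence
    both are at most [K m_s], where [m_s = (1 - s) p + s q], and
    [|m_t - m_s| = |t - s| |q - p| <= K |t - s| m_s].  So
    [m_t <= (1 + K |t - s|) m_s], and symmetrically in [s] and [t]: two metrics
    of the segment are at distance at most [ln (1 + K |t - s|) <= K |t - s|]
    ([segment_le], [segment_dist_lt]).  The path is therefore Lipschitz.  The
    same estimate between the times [t] and [0] compares [(1 - t) a + t b] with
    [a], hence locally with Euclidean metrics, so that every point of the segment
    is a rough metric ([segment_rough]).

    The nonnegativity of [a] and [b] has to be proved, because the norm of [u]
    is the square root of [g(u, u)], which vanishes on negative numbers: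
    comparing norms alone does not bound the values [g(u, u) < 0].
    Comparison with a Euclidean metric excludes such vectors almost everywhere
    in a chart, and second countability of the manifold turns this into an
    almost everywhere statement on the whole manifold ([ae_on_local],
    [rough_metric_ge0]). *)

(** * Null sets are a local notion *)

Section null_sets.
Context {R : realType} {n : nat} {M : smoothManifold R n}.

Lemma null_set_bigcup (F : nat -> set M) :
  (forall i, Defs.null_set (F i)) -> Defs.null_set (\bigcup_i F i).
Proof.
move=> F0 c ac; apply/eqP; rewrite eq_le lebesgue_outer_ge0 andbT.
rewrite setI_bigcupl image_bigcup.
apply: (le_trans (outer_measure_sigma_subadditive (@lebesgue_outer R n) _)).
by rewrite eseries0// => i _ _; apply: F0.
Qed.

Lemma null_set_countable_bigcup (I : Type) (B : set I) (F : I -> set M) :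
  countable B -> (forall i, B i -> Defs.null_set (F i)) ->
  Defs.null_set (\bigcup_(i in B) F i).
Proof.
move=> /countable_injP[f f_inj] F0.
pose G k := \bigcup_(i in [set i | B i /\ f i = k]) F i.
apply: (@null_setS _ _ _ _ (\bigcup_k G k)).
  by move=> x [i Bi Fix]; exists (f i) => //; exists i.
apply: null_set_bigcup => k.
have [[i [Bi fi]]|noi] := pselect (exists i, B i /\ f i = k).
  refine (null_setS _ (F0 i Bi)) => x [j [Bj fj] Fjx].
  by rewrite (f_inj i j) ?inE ?fi ?fj.
refine (null_setS _ (@null_set0 R n M)) => x [i Bi _].
by apply: noi; exists i.
Qed.

(** Lindelof's argument: of a countable basis, the open sets on which [P] holds
    almost everywhere already cover the manifold. *)
Lemma ae_on_local (P : M -> Prop) :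
  (forall x : M, exists2 c, charts_at x c & ae_on (cdom c) P) -> ae_on setT P.
Proof.
move=> Ploc; have [B Bcount [_ Bbasis]] := manifold_second_countable M.
pose bad (b : set M) := b `&` [set x | ~ P x].
pose good : set (set M) := [set b | B b /\ Defs.null_set (bad b)].
apply: (@null_setS _ _ _ _ (\bigcup_(b in good) bad b)); last first.
  apply: null_set_countable_bigcup => [|b []//].
  by apply: sub_countable Bcount; apply: subset_card_le => b [].
move=> x [_ nPx]; have [c [ac xc] Pc] := Ploc x.
have [b [Bb bx] bc] := Bbasis x _ (near_cdom xc).
exists b => //; split=> //; refine (null_setS _ Pc) => y [yb nPy].
by split=> //; exact: bc.
Qed.

End null_sets.

(** * Rough metrics are positive semidefinite almost everywhere *)

Section nonnegativity.
Context {R : realType} {n : nat} {M : smoothManifold R n}.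

Lemma tangent_eq0 (x : M) c (u : tangent x) : charts_at x c -> u c = 0 -> u = 0.
Proof.
move=> xc uc0; apply/val_inj/funext => d /=.
have /asboolP[trans dummy] := tcoordP u.
have [xd|/dummy//] := pselect (charts_at x d).
by rewrite (trans c d)// uc0 /transition_diff linear0.
Qed.

Lemma form0l (k : sym_form_field M) (x : M) (v : tangent x) : k x 0 v = 0.
Proof.
have := (form_bilinear k x).1 v (-1) 0 0.
by rewrite scaler0 addr0 /= mulN1r addNr.
Qed.

Lemma chart_norm_eq0 (x : M) c (u : tangent x) :
  charts_at x c -> chart_norm c u <= 0 -> u = 0.
Proof.
move=> xc; rewrite /chart_norm le_eqVlt ltNge sqrtr_ge0 orbF sqrtr_eq0 => u0.
apply: (tangent_eq0 xc); apply/rowP => i; rewrite mxE.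
have sq_ge0 j : true -> 0 <= (u c 0 j) ^+ 2 by rewrite sqr_ge0.
have /eqP : \sum_(j < n) (u c 0 j) ^+ 2 = 0.
  by apply/eqP; rewrite eq_le u0 sumr_ge0.
rewrite psumr_eq0// => /allP/(_ i); rewrite mem_index_enum => /(_ isT)/=.
by rewrite sqrf_eq0 => /eqP.
Qed.

(** If [g(u, u) < 0] then [u] has norm zero for [g], hence zero coordinates in a
    chart where [g] is comparable to the Euclidean metric; so [u = 0], which
    contradicts [g(u, u) < 0]. *)
Lemma rough_metric_ge0 (g : rough_metric M) :
  ae_on setT (fun x => forall u : tangent x, 0 <= g x u u).
Proof.
apply: ae_on_local => x; have [c xc [C C1 gc]] := rough_comparable g x.
exists c => //; refine (null_setS _ gc) => y [yc ng]; split=> // cmp.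
apply: ng => u; rewrite leNgt; apply/negP => guu.
suff u0 : u = 0 by move: guu; rewrite u0 form0l ltxx.
apply: (chart_norm_eq0 (c := c)); first by split=> //; case: xc.
have /andP[+ _] := cmp u.
rewrite /form_norm ler0_sqrtr ?(ltW guu)// pmulr_rle0// invr_gt0.
exact: lt_le_trans C1.
Qed.

End nonnegativity.

(** * Comparison of quadratic forms along a segment *)

Section comparison.
Context {R : realType}.
Implicit Types C D K p q s t : R.

Lemma sqrt_compareP C p q : 1 <= C -> 0 <= p -> 0 <= q ->
  (C^-1 * Num.sqrt q <= Num.sqrt p <= C * Num.sqrt q) =
  (q <= C ^+ 2 * p) && (p <= C ^+ 2 * q).
Proof.
move=> C1 p0 q0; have C0 : 0 < C by rewrite (lt_le_trans _ C1).
have le_sqrt z w : 0 <= w ->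
    (Num.sqrt z <= C * Num.sqrt w) = (z <= C ^+ 2 * w).
  move=> w0; rewrite -{1}(gtr0_norm C0) -sqrtr_sqr -sqrtrM ?sqr_ge0//.
  by rewrite ler_sqrt// mulr_ge0 ?sqr_ge0.
by rewrite ler_pdivrMl// !le_sqrt.
Qed.

(** This is what makes the segment Lipschitz: each endpoint is at most [K] times
    any convex combination [m] of the two, hence so is their difference, which is
    the speed at which the combination moves. *)
Lemma segment_le K p q s t : 1 <= K -> 0 <= p -> 0 <= q ->
  p <= K * q -> q <= K * p -> 0 <= s <= 1 ->
  (1 - t) * p + t * q <= (1 + K * `|t - s|) * ((1 - s) * p + s * q).
Proof.
move=> K1 p0 q0 pq qp /andP[s0 s1].
set m := (1 - s) * p + s * q.
have K0 : 0 <= K by lra.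
have le_m z : z <= K * p -> z <= K * q -> z <= K * m.
  move=> zp zq; have h1 : (1 - s) * z <= (1 - s) * (K * p).
    by apply: ler_wpM2l; rewrite ?subr_ge0.
  have h2 : s * z <= s * (K * q) by apply: ler_wpM2l.
  by rewrite /m; lra.
have pm : p <= K * m by apply: le_m; rewrite ?ler_peMl.
have qm : q <= K * m by apply: le_m; rewrite ?ler_peMl.
have dm : `|q - p| <= K * m by rewrite ler_norml; apply/andP; split; lra.
have -> : (1 - t) * p + t * q = m + (t - s) * (q - p) by rewrite /m; lra.
rewrite [leRHS]mulrDl mul1r lerD2l (le_trans (ler_norm _))// normrM.
by rewrite mulrAC [leRHS]mulrC; apply: ler_wpM2l.
Qed.

(** The ratio of the norms is at most the square root of [D = 1 + K |s - t|]; the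
    bound by [D] itself is simpler and has the same order as [s - t] tends to
    [0]. *)
Lemma segment_compare K p q s t : 1 <= K -> 0 <= p -> 0 <= q ->
  p <= K * q -> q <= K * p -> 0 <= s <= 1 -> 0 <= t <= 1 ->
  (1 + K * `|s - t|)^-1 * Num.sqrt ((1 - t) * p + t * q) <=
    Num.sqrt ((1 - s) * p + s * q) <=
  (1 + K * `|s - t|) * Num.sqrt ((1 - t) * p + t * q).
Proof.
move=> K1 p0 q0 pq qp s01 t01.
pose m r := (1 - r) * p + r * q; rewrite -/(m s) -/(m t).
set D := 1 + _.
have m_ge0 r : 0 <= r <= 1 -> 0 <= m r.
  by move=> /andP[r0 r1]; rewrite /m addr_ge0 ?mulr_ge0 ?subr_ge0.
have D1 : 1 <= D by rewrite lerDl mulr_ge0//; lra.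
have DD r : 0 <= m r -> D * m r <= D ^+ 2 * m r.
  by move=> mr; apply: ler_wpM2r => //; rewrite expr2; nra.
rewrite sqrt_compareP ?m_ge0//; apply/andP; split.
  by apply: le_trans (DD _ (m_ge0 _ s01)); rewrite /D distrC; exact: segment_le.
by apply: le_trans (DD _ (m_ge0 _ t01)); exact: segment_le.
Qed.

End comparison.

(** * The segment joining two rough metrics *)

Section segment.
Context {R : realType} {n : nat} {M : smoothManifold R n}.

Section segment_field.
Variables (a b : sym_form_field M) (t : R).

Definition segment_fun (x : M) (u v : tangent x) : R :=
  (1 - t) * a x u v + t * b x u v.

Lemma segment_sym (x : M) (u v : tangent x) :
  segment_fun u v = segment_fun v u.
Proof. by rewrite /segment_fun (form_sym a) (form_sym b). Qed.

Lemma segment_bilinear (x : M) : bilinear_for *%R *%R (@segment_fun x).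
Proof.
have [al ar] := form_bilinear a x; have [bl br] := form_bilinear b x.
split=> [v r u w|u r v w]; rewrite /segment_fun.
  by rewrite al bl /=; lra.
by rewrite ar br /=; lra.
Qed.

Definition segment_field : sym_form_field M :=
  SymFormField segment_sym segment_bilinear.

Lemma segment_measurable :
  form_measurable a -> form_measurable b -> form_measurable segment_field.
Proof.
move=> ma mb c ac i j; apply: measurable_funD; apply: measurable_funM;
  by [exact: measurable_cst | exact: ma | exact: mb].
Qed.

End segment_field.

Lemma segment_field0 (a b : sym_form_field M) (x : M) (u v : tangent x) :
  segment_field a b 0 x u v = a x u v.
Proof. by rewrite /= /segment_fun subr0 mul1r mul0r addr0. Qed.

Lemma segment_field1 (a b : sym_form_field M) (x : M) (u v : tangent x) :
  segment_field a b 1 x u v = b x u v.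
Proof. by rewrite /= /segment_fun subrr mul0r mul1r add0r. Qed.

(** Reduces the chartwise condition defining rough metrics to a global
    comparison with a metric already known to be rough. *)
Lemma comparable_locally_comparable (g : rough_metric M) (k : sym_form_field M)
    (D : R) : 1 <= D ->
  ae_on setT (fun x => forall u : tangent x,
    D^-1 * form_norm g u <= form_norm k u <= D * form_norm g u) ->
  locally_comparable k.
Proof.
move=> D1 gk x; have [c xc [C C1 gc]] := rough_comparable g x.
have C0 : 0 < C by rewrite (lt_le_trans _ C1).
have D0 : 0 < D by rewrite (lt_le_trans _ D1).
exists c => //; exists (D * C); first by rewrite -[1]mulr1 ler_pM.
have gk' : ae_on (cdom c) (fun y => forall u : tangent y,
    D^-1 * form_norm g u <= form_norm k u <= D * form_norm g u).
  by refine (null_setS _ gk) => y [_ ?]; split.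
apply: ae_imply2 gk' gc => y gk1 gc1 u.
have /andP[k1 k2] := gk1 u; have /andP[g1 g2] := gc1 u.
apply/andP; split.
  by rewrite invfM -mulrA (le_trans _ k1)// ler_pM2l// invr_gt0.
by rewrite -mulrA (le_trans k2)// ler_pM2l.
Qed.

Section between_metrics.
Context {a b : rough_metric M} {C : R} (C1 : 1 <= C) (ab : metric_sim C a b).

Let K := C ^+ 2.

Lemma segment_field_compare (s t : R) : 0 <= s <= 1 -> 0 <= t <= 1 ->
  let D := 1 + K * `|s - t| in
  ae_on setT (fun x => forall u : tangent x,
    D^-1 * form_norm (segment_field a b t) u <=
      form_norm (segment_field a b s) u <=
    D * form_norm (segment_field a b t) u).
Proof.
move=> s01 t01 D.
have := ae_imply2 (fun x p q => conj p q) (rough_metric_ge0 a) (rough_metric_ge0 b).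
apply: ae_imply2 (ab) => x cmp [a0 b0] u; have := cmp u.
rewrite /form_norm sqrt_compareP// => /andP[ba ab'].
by apply: segment_compare => //; rewrite /K exprn_ege1.
Qed.

Lemma segment_rough (t : R) : 0 <= t <= 1 ->
  exists k : rough_metric M, rough_form k = segment_field a b t.
Proof.
move=> t01.
have mk := segment_measurable t (@rough_measurable _ _ _ a)
  (@rough_measurable _ _ _ b).
suff lk : locally_comparable (segment_field a b t) by exists (RoughMetric mk lk).
have D1 : 1 <= 1 + K * `|t - 0| by rewrite lerDl mulr_ge0 ?sqr_ge0.
apply: (comparable_locally_comparable (g := a) D1).
(* [a] is the point of the segment at time [0]. *)
have := @segment_field_compare t 0 t01; rewrite lexx ler01 => /(_ isT).
apply: ae_imply => x cmp u; have := cmp u.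
have -> : form_norm (segment_field a b 0) u = form_norm a u by
  rewrite /form_norm segment_field0.
exact.
Qed.

Lemma segment_dist_lt (ks kt : rough_metric M) (s t e : R) :
  rough_form ks = segment_field a b s -> rough_form kt = segment_field a b t ->
  0 <= s <= 1 -> 0 <= t <= 1 -> K * `|s - t| < e ->
  (rough_dist ks kt < e%:E)%E.
Proof.
move=> ksE ktE s01 t01 ste; apply/rough_dist_ltP.
have K0 : 0 <= K * `|s - t| by rewrite mulr_ge0 ?sqr_ge0.
exists (1 + K * `|s - t|); split; first by rewrite lerDl.
  by rewrite /metric_sim ksE ktE; exact: segment_field_compare.
by apply: le_lt_trans ste; rewrite le_ln1Dx// (lt_le_trans _ K0)// ltrN10.
Qed.

End between_metrics.

End segment.

(** * Connecting points at finite distance *)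

Section paths.
Context {R : realType} {n : nat} {M : smoothManifold R n}.
Implicit Types x y z : Met M.

Lemma Met_dist_finP x y : (Met_dist x y < +oo)%E <-> exists e : R, Met_ball x e y.
Proof.
split=> [|[e /lt_trans]]; last by apply; rewrite ltry.
move=> /ereal_inf_lt[_ [C [C1 xy] <-] _]; exists (ln C + 1).
by apply/rough_dist_ltP; exists C; split=> //; rewrite ltrDl.
Qed.

(** The extended metric is finite exactly between comparable metrics, so the
    triangle inequality through [g] yields a single ratio [C] between [x] and
    [y], from which the Lipschitz constant of the path is made. *)
Lemma Comp_sim (g x y : Met M) : Comp g x -> Comp g y ->
  exists2 C : R, 1 <= C & metric_sim C (repr x) (repr y).
Proof.
move=> /Met_dist_finP[d gx] /Met_dist_finP[e gy].
have /rough_dist_ltP[C [C1 xy _]] := Met_ball_triangle (Met_ball_sym gx) gy.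
by exists C.
Qed.

Lemma Met_eq_repr (k : rough_metric M) x :
  (forall (z : M) (u v : tangent z), k z u v = repr x z u v) -> \pi_(Met M) k = x.
Proof.
move=> kx; rewrite -[RHS]reprK; apply/(@eqquotP _ _ (Met M)).
by apply/asboolP; apply: ae_all.
Qed.

End paths.

Theorem theorem2p6 (R : realType) (n : nat) (M : smoothManifold R n)
  (hM : connected [set: M]) (g : Met M) : path_connected R (Comp g).
Proof.
move=> x y gx gy; have [C C1 xy] := Comp_sim gx gy.
(* Outside the unit interval the combination may fail to be a rough metric, and
   the value of the path there is arbitrary. *)
have /choice[k kE] : forall t : R, exists k : rough_metric M, 0 <= t <= 1 ->
    rough_form k = segment_field (repr x) (repr y) t.
  move=> t; have [t01|_] := boolP (0 <= t <= 1); last by exists (repr x).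
  by have [k kE] := segment_rough C1 xy t01; exists k.
pose p t := \pi_(Met M) (k t).
have p_ball (s t e : R) : 0 <= s <= 1 -> 0 <= t <= 1 ->
    C ^+ 2 * `|s - t| < e -> Met_ball (p s) e (p t).
  move=> s01 t01 ste; rewrite /Met_ball Met_distE.
  by apply: (segment_dist_lt C1 xy (s := s) (t := t)) ste => //; exact: kE.
have p0 : p 0 = x.
  by apply: Met_eq_repr => z u v; rewrite kE ?lexx ?ler01// segment_field0.
have p1 : p 1 = y.
  by apply: Met_eq_repr => z u v; rewrite kE ?lexx ?ler01// segment_field1.
exists p; split=> //.
- apply/subspace_continuousP => s; rewrite /= in_itv /= => s01.
  apply/cvg_ballP => e e0.
  have C20 : 0 < C ^+ 2 by rewrite exprn_gt0// (lt_le_trans _ C1).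
  have : \forall t \near s, `|s - t| < e / C ^+ 2.
    by apply: (@cvgr_dist_lt _ R^o R (nbhs s) _ id s cvg_id); rewrite divr_gt0.
  apply: filterS => t st; rewrite /= in_itv /= => t01.
  by apply: p_ball => //; rewrite -ltr_pdivlMl// mulrC.
- move=> t; rewrite in_itv /= => t01; apply/Met_dist_finP.
  (* Go from [g] to [x], then along the segment; the added [1] only makes the
     Lipschitz bound strict. *)
  have /Met_dist_finP[e ge] := gx; exists (e + (C ^+ 2 * `|0 - t| + 1)).
  apply: Met_ball_triangle ge _; rewrite -p0.
  by apply: p_ball; rewrite ?lexx ?ler01 ?ltrDl.
Qed.
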